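(* Let $V$ be a positive definite quadratic space over $\mathbb{Q}$ with symmetric bilinear form $b$, $\varphi(v)=b(v,v)$, and let $L=\mathbb{Z}v_1+\cdots+\mathbb{Z}v_n$ be a lattice with $\mathbb{Q}L=V$, of even rank $n$, whose Gram matrix is diagonal $\langle a_1,\dots,a_n\rangle$ with positive integers $a_j$ and $\gcd(a_1,\dots,a_n)=1$. Let $c\in\mathbb{Z}$ and $N\in\mathbb{Z}_{>0}$ with $\gcd(c,N)=1$, put $\nu=-\frac{c}{N}(v_1+\cdots+v_n)$ and $X=L+\nu$, and let $h\in\mathbb{Q}$ satisfy $h-\sum_{j=1}^n a_j(c/N)^2\in 8(\gcd(N,4)N)^{-1}\mathbb{Z}$. Then for every odd prime $p$ dividing $N$, \[ b_p(h,\lambda,0)=p^{-\mathrm{ord}_pN}. \]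
   Context: For a prime $p$ let $V_p=V\otimes\mathbb{Q}_p$, $L_p=L\otimes\mathbb{Z}_p$, $X_p=L_p+\nu$, and let $\lambda_p$ be the characteristic function of $X_p$. For $z\in\mathbb{Q}_p$ set $\mathbf{e}_p(z):=e^{-2\pi i y}$ where $y\in\mathbb{Z}[1/p]$ is such that $z-y\in\mathbb{Z}_p$. Let $dv$ be the Haar measure on $V_p$ with $\int_{L_p}dv=1$ and $d\sigma$ the Haar measure on $\mathbb{Q}_p$ with $\int_{\mathbb{Z}_p}d\sigma=1$. The local density is $b_p(h,\lambda,0):=\int_{\mathbb{Q}_p}\int_{V_p}\mathbf{e}_p(\sigma(\varphi(v)-h))\lambda_p(v)\,dv\,d\sigma$. *)

(* Defs.v *)
From HB Require Import structures.
From mathcomp Require Import all_boot all_order all_algebra.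
From mathcomp Require Import generic_quotient ring_quotient.
From mathcomp Require Import all_classical all_reals all_analysis.
From mathcomp Require Import complex ring.

Set Implicit Arguments.
Unset Strict Implicit.
Unset Printing Implicit Defensive.

Import Order.TTheory GRing.Theory Num.Theory.
Import numFieldNormedType.Exports.

Local Open Scope classical_set_scope.
Local Open Scope ring_scope.

Definition padic_val (p : nat) (x : rat) : int :=
  (logn p `|numq x|)%:Z - (logn p `|denq x|)%:Z.

Definition padic_abs (p : nat) (x : rat) : rat :=
  if x == 0 then 0 else p%:R ^ (- padic_val p x).

Section padic_abs_theory.
Variables (p : nat) (p_pr : prime p).
Local Notation abs := (padic_abs p).

Let p_gt0 : 0 < p%:R :> rat. Proof. by rewrite ltr0n prime_gt0. Qed.
Let p_gt1 : 1 < p%:R :> rat. Proof. by rewrite ltr1n prime_gt1. Qed.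

Lemma padic_valE (m d : int) : m != 0 -> d != 0 ->
  padic_val p (m%:~R / d%:~R) = (logn p `|m|)%:Z - (logn p `|d|)%:Z.
Proof.
move=> m0 d0; set x := _ / _.
have x0 : x != 0 by rewrite mulf_neq0 ?invr_eq0 ?intr_eq0.
have E : numq x * d = m * denq x.
  apply/eqP; rewrite -(eqr_int rat) !intrM -[X in X * _]/((numq x)%:~R : rat).
  by rewrite numqE /x mulrAC divfK ?intr_eq0.
have := congr1 (fun z : int => logn p `|z|%N) E.
rewrite !abszM !lognM ?absz_gt0 ?numq_eq0 ?denq_neq0 // => {}E.
rewrite /padic_val; apply/eqP; rewrite subr_eq addrAC eq_sym subr_eq.
by rewrite -!PoszD E.
Qed.

Lemma padic_abs0 : abs 0 = 0. Proof. by rewrite /padic_abs eqxx. Qed.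

Lemma padic_abs_gt0 x : (0 < abs x) = (x != 0).
Proof.
by rewrite /padic_abs; case: eqVneq => [_|_]; rewrite ?ltxx // exprz_gt0.
Qed.

Lemma padic_abs_ge0 x : 0 <= abs x.
Proof. by have [->|] := eqVneq x 0; [rewrite padic_abs0|rewrite -padic_abs_gt0 => /ltW]. Qed.

Lemma padic_abs_eq0 x : (abs x == 0) = (x == 0).
Proof. by apply: negb_inj; rewrite -(padic_abs_gt0 x) lt0r padic_abs_ge0 andbT. Qed.

Lemma padic_abs1 : abs 1 = 1.
Proof. by rewrite /padic_abs oner_eq0 /padic_val /= logn1 subrr oppr0 expr0z. Qed.

Lemma padic_absM x y : abs (x * y) = abs x * abs y.
Proof.
have [->|x0] := eqVneq x 0; first by rewrite !(mul0r, padic_abs0).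
have [->|y0] := eqVneq y 0; first by rewrite !(mulr0, padic_abs0).
rewrite /padic_abs mulf_eq0 !(negPf x0, negPf y0) /= -expfzDr ?gt_eqF //.
congr (_ ^ _); rewrite -opprD; congr (- _).
rewrite -{1}[x]divq_num_den -{1}[y]divq_num_den mulf_div -!intrM padic_valE.
- rewrite !abszM !lognM ?absz_gt0 ?numq_eq0 ?denq_neq0 // !PoszD opprD.
  by rewrite addrACA.
- by rewrite mulf_neq0 ?numq_eq0.
- by rewrite mulf_neq0 ?denq_neq0.
Qed.

Lemma padic_absN x : abs (- x) = abs x.
Proof. by rewrite /padic_abs oppr_eq0 /padic_val numqN denqN abszN. Qed.

Lemma padic_absB x y : abs (x - y) = abs (y - x).
Proof. by rewrite -padic_absN opprB. Qed.

Lemma padic_absV x : abs x^-1 = (abs x)^-1.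
Proof.
have [->|x0] := eqVneq x 0; first by rewrite !(invr0, padic_abs0).
by apply: (mulIf (x:=abs x)); rewrite ?padic_abs_eq0 // -padic_absM !mulVf ?padic_abs1 // padic_abs_eq0.
Qed.

Lemma padic_abs_int_le1 (m : int) : abs m%:~R <= 1.
Proof.
have [->|m0] := eqVneq m 0; first by rewrite padic_abs0.
rewrite /padic_abs intr_eq0 (negPf m0) -[m%:~R]divr1 -[1]/(1%:~R) padic_valE //.
by rewrite logn1 subr0 -exprnN invf_le1 ?exprn_gt0 // exprn_ege1 // ltW.
Qed.

Lemma padic_absD x y : abs (x + y) <= Num.max (abs x) (abs y).
Proof.
wlog xy : x y / abs y <= abs x.
  by move=> H; case/orP: (le_total (abs y) (abs x)) => /H //; rewrite addrC maxC.
rewrite (max_l xy).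
have [x0|x0] := eqVneq x 0.
  rewrite x0 padic_abs0 in xy *.
  by rewrite add0r.
rewrite -{1}[x]mul1r -[y](mulfVK x0) -mulrDl padic_absM ler_piMl ?padic_abs_ge0 //.
have : abs (y / x) <= 1.
  by rewrite padic_absM padic_absV ler_pdivrMr ?padic_abs_gt0 // mul1r.
move: (y / x) => {xy x0}x y1.
have [->|x0] := eqVneq x 0; first by rewrite addr0 padic_abs1.
have ndvd : ~~ (p %| `|denq x|)%N.
  apply: contraTN y1 => pd.
  have pn : ~~ (p %| `|numq x|)%N.
    apply/negP => pn; have := dvdn_gcd p `|numq x| `|denq x|.
    have /eqP -> := coprime_num_den x.
    by rewrite pn pd dvdn1 => /eqP p1; move: (prime_gt1 p_pr); rewrite p1.
  rewrite -ltNge /padic_abs (negPf x0) /padic_val.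
  rewrite [logn p `|numq x|]lognE (negPf pn) !andbF sub0r opprK.
  rewrite -exprnP exprn_egt1 // -lt0n logn_gt0 mem_primes p_pr absz_gt0 denq_neq0.
  exact: pd.
have d1 : abs (denq x)%:~R = 1.
  rewrite /padic_abs intr_eq0 (negPf (denq_neq0 _)) -[(denq x)%:~R]divr1.
  rewrite -[1]/(1%:~R) padic_valE ?denq_neq0 // logn1 subr0.
  by rewrite [logn _ _]lognE (negPf ndvd) !andbF.
have -> : 1 + x = (denq x + numq x)%:~R / (denq x)%:~R.
  by rewrite intrD mulrDl divff ?intr_eq0 ?denq_neq0 // divq_num_den.
by rewrite padic_absM padic_absV d1 divr1 padic_abs_int_le1.
Qed.

End padic_abs_theory.

Section padic_cauchy.
Variables (p : nat) (p_pr : prime p).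
Local Notation abs := (padic_abs p).

Definition padic_cauchy (u : nat -> rat) := forall e : rat, 0 < e ->
  exists k, forall m n, (k <= m)%N -> (k <= n)%N -> abs (u m - u n) < e.

Definition padic_null (u : nat -> rat) := forall e : rat, 0 < e ->
  exists k, forall n, (k <= n)%N -> abs (u n) < e.

(* The unused primality argument lets the closure proofs below be found by
   unification. *)
Definition padic_cauchyb & prime p : {pred nat -> rat} :=
  fun u => `[< padic_cauchy u >].

Lemma padic_ltD x y e : abs x < e -> abs y < e -> abs (x + y) < e.
Proof.
by move=> xe ye; rewrite (le_lt_trans (padic_absD p_pr x y)) // gt_max xe.
Qed.

Lemma padic_cauchy_bounded u : padic_cauchy u ->
  exists2 M, 0 < M & forall n, abs (u n) < M.
Proof.
move=> /(_ 1 ltr01)[k uk].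
have [M M0 HM] : exists2 M, 0 < M & forall n, (n < k)%N -> abs (u n) < M.
  elim: k {uk} => [|k [M M0 IH]]; first by exists 1.
  exists (Num.max M (abs (u k) + 1)); first by rewrite lt_max M0.
  move=> n; rewrite ltnS leq_eqVlt => /orP[/eqP ->|/IH nM].
    by rewrite lt_max ltrDl ltr01 orbT.
  by rewrite lt_max nM.
exists (Num.max M (abs (u k) + 1)); first by rewrite lt_max M0.
move=> n; case: (ltnP n k) => [/HM nM|kn]; first by rewrite lt_max nM.
rewrite lt_max; apply/orP; right; rewrite -[u n](subrK (u k)).
apply: padic_ltD; last by rewrite ltrDl.
by rewrite (lt_le_trans (uk _ _ kn (leqnn k))) // lerDr padic_abs_ge0.
Qed.

Lemma padic_cauchy_closed : subring_closed (padic_cauchyb p_pr).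
Proof.
split=> [|u v|u v]; rewrite /padic_cauchyb !unfold_in.
- by apply/asboolP => e e0; exists 0%N => m n _ _; rewrite subrr padic_abs0.
- move=> /asboolP cu /asboolP cv; apply/asboolP => e e0.
  have [k uk] := cu e e0; have [l vl] := cv e e0.
  exists (maxn k l) => m n; rewrite !geq_max => /andP[km lm] /andP[kn ln].
  have -> : (u - v) m - (u - v) n = (u m - u n) + (v n - v m).
    by rewrite !fctE; ring.
  by apply: padic_ltD; [exact: uk|exact: vl].
- move=> /asboolP cu /asboolP cv; apply/asboolP => e e0.
  have [M M0 uM] := padic_cauchy_bounded cu.
  have [M' M0' vM] := padic_cauchy_bounded cv.
  have [k uk] := cu (e / M') (divr_gt0 e0 M0').
  have [l vl] := cv (e / M) (divr_gt0 e0 M0).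
  exists (maxn k l) => m n; rewrite !geq_max => /andP[km lm] /andP[kn ln].
  have -> : (u * v) m - (u * v) n = (u m - u n) * v m + u n * (v m - v n).
    by rewrite !fctE mulrBl mulrBr addrA subrK.
  apply: padic_ltD; rewrite padic_absM //.
    rewrite -(divfK (lt0r_neq0 M0') e) ltr_pM ?padic_abs_ge0 //; exact: uk.
  rewrite mulrC -(divfK (lt0r_neq0 M0) e) ltr_pM ?padic_abs_ge0 //; exact: vl.
Qed.

HB.instance Definition _ :=
  GRing.isSubringClosed.Build (nat -> rat) (padic_cauchyb p_pr)
    padic_cauchy_closed.

Record padic_cauchy_seq := PadicCauchySeq {
  padic_seq :> nat -> rat;
  padic_seqP : padic_seq \in padic_cauchyb p_pr
}.

HB.instance Definition _ := [isSub for padic_seq].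
HB.instance Definition _ := [Choice of padic_cauchy_seq by <:].
HB.instance Definition _ :=
  [SubChoice_isSubComNzRing of padic_cauchy_seq by <:].

Definition padic_nullb : {pred padic_cauchy_seq} :=
  fun u => `[< padic_null (u : nat -> rat) >].

Lemma padic_null_closed : idealr_closed padic_nullb.
Proof.
split=> [|| a u v]; rewrite /padic_nullb !unfold_in.
- by apply/asboolP => e e0; exists 0%N => n _; rewrite padic_abs0.
- apply/negP => /asboolP/(_ 1 ltr01)[k /(_ k (leqnn k))].
  by rewrite padic_abs1 ltxx.
- move=> /asboolP nu /asboolP nv; apply/asboolP => e e0.
  have [M M0 aM] := padic_cauchy_bounded (asboolW (padic_seqP a)).
  have [k uk] := nu (e / M) (divr_gt0 e0 M0); have [l vl] := nv e e0.
  exists (maxn k l) => n; rewrite geq_max => /andP[kn ln].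
  apply: (@padic_ltD (a n * u n)); last exact: vl.
  rewrite padic_absM // mulrC -(divfK (lt0r_neq0 M0) e) ltr_pM ?padic_abs_ge0 //.
  exact: uk.
Qed.

HB.instance Definition _ :=
  isIdealr.Build padic_cauchy_seq padic_nullb padic_null_closed.

Definition Qp : Type := {ideal_quot padic_nullb}.

HB.instance Definition _ := GRing.ComNzRing.on Qp.


Definition Qp_of (u : padic_cauchy_seq) : Qp :=
  \pi_({ideal_quot padic_nullb})%qT u.

Lemma Qp_of_repr x : Qp_of (repr x) = x. Proof. exact: reprK. Qed.

Lemma Qp_of0 : Qp_of 0 = 0.
Proof. exact: (rmorph0 (\pi_({ideal_quot padic_nullb})%qT)). Qed.

Lemma Qp_of1 : Qp_of 1 = 1.
Proof. exact: (rmorph1 (\pi_({ideal_quot padic_nullb})%qT)). Qed.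

Lemma Qp_ofN u : Qp_of (- u) = - Qp_of u.
Proof. exact: (rmorphN (\pi_({ideal_quot padic_nullb})%qT)). Qed.

Lemma Qp_ofD u v : Qp_of (u + v) = Qp_of u + Qp_of v.
Proof. exact: (rmorphD (\pi_({ideal_quot padic_nullb})%qT)). Qed.

Lemma Qp_ofM u v : Qp_of (u * v) = Qp_of u * Qp_of v.
Proof. exact: (rmorphM (\pi_({ideal_quot padic_nullb})%qT)). Qed.

Lemma Qp_of_eq u v : Qp_of u = Qp_of v <-> padic_null (fun n => u n - v n).
Proof.
rewrite (rwP eqP) -Quotient.idealrBE /padic_nullb unfold_in.
by split => [/asboolW|?] //; apply/asboolP.
Qed.

Lemma Qp_of_eq0 u : Qp_of u = 0 <-> padic_null u.
Proof.
rewrite -Qp_of0 Qp_of_eq; suff -> : (fun n => u n - (0 : padic_cauchy_seq) n) = u by [].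
by apply/funext => n; rewrite subr0.
Qed.

Lemma padic_abs_isosceles x y : abs (x - y) < abs y -> abs x = abs y.
Proof.
move=> xy; apply/eqP; rewrite eq_le; apply/andP; split.
  by rewrite -{1}(subrK y x) (le_trans (padic_absD p_pr _ _)) // ge_max lexx ltW.
rewrite leNgt; apply/negP => ltxy.
have yx : abs (y - x) < abs y by rewrite padic_absB.
by have := padic_ltD ltxy yx; rewrite addrC subrK ltxx.
Qed.

Lemma padic_cauchy_abs u : padic_cauchy u -> ~ padic_null u ->
  exists2 c, 0 < c & exists k, forall n, (k <= n)%N -> abs (u n) = c.
Proof.
move=> cu /existsNP[e] /not_implyP[e0] /forallNP nu.
have [k uk] := cu e e0.
have /existsNP[m] := nu k; move=> /not_implyP[km /negP]; rewrite -leNgt => em.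
exists (abs (u m)); first exact: lt_le_trans em.
exists k => n kn; apply: padic_abs_isosceles.
by rewrite (lt_le_trans (uk _ _ kn km)).
Qed.

Lemma padic_seq_cauchy (u : padic_cauchy_seq) : padic_cauchy u.
Proof. exact: asboolW (padic_seqP u). Qed.

Lemma Qp_inv_ex (x : Qp) : x != 0 -> exists y, y * x = 1.
Proof.
rewrite -[x]Qp_of_repr; set u : padic_cauchy_seq := repr x.
move=> /eqP/Qp_of_eq0 nu.
have [c c0 [k uk]] := padic_cauchy_abs (@padic_seq_cauchy u) nu.
have u0 n : (k <= n)%N -> u n != 0.
  by move=> kn; rewrite -(padic_abs_gt0 p_pr) uk.
have cv : (fun n => (u n)^-1) \in padic_cauchyb p_pr.
  rewrite unfold_in; apply/asboolP => e e0.
  have [l ul] := @padic_seq_cauchy u (e * c ^+ 2) (mulr_gt0 e0 (exprn_gt0 2 c0)).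
  exists (maxn k l) => m n; rewrite !geq_max => /andP[km lm] /andP[kn ln].
  have -> : (u m)^-1 - (u n)^-1 = (u n - u m) / (u m * u n).
    by field; rewrite !u0.
  rewrite padic_absM // padic_absV // padic_absM // !uk //.
  by rewrite ltr_pdivrMr ?mulr_gt0 // -expr2 ul.
exists (Qp_of (PadicCauchySeq cv)); rewrite -Qp_ofM -Qp_of1.
apply/Qp_of_eq => e e0; exists k => n kn.
have -> : (PadicCauchySeq cv * u) n = (u n)^-1 * u n by [].
by rewrite mulVf ?u0 // subrr padic_abs0.
Qed.

Definition Qp_inv (x : Qp) : Qp := xget 0 [set y | y * x = 1].

Lemma Qp_mulVf (x : Qp) : x != 0 -> Qp_inv x * x = 1.
Proof. by move=> /Qp_inv_ex[y yx]; rewrite /Qp_inv; case: xgetP => [z _ //|/(_ y)]. Qed.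

Lemma Qp_invr0 : Qp_inv 0 = 0.
Proof.
rewrite /Qp_inv; case: xgetP => // y _ /=.
by rewrite mulr0 => /esym/eqP; rewrite oner_eq0.
Qed.

HB.instance Definition _ := GRing.ComNzRing_isField.Build Qp Qp_mulVf Qp_invr0.

Definition Qp_norm (x : Qp) : rat :=
  lim ((padic_abs p ((repr x : padic_cauchy_seq) n) : rat^o) @[n --> \oo]).

Lemma Qp_norm0 : Qp_norm 0 = 0.
Proof.
apply: (@cvg_lim rat^o); first exact: norm_hausdorff.
apply/(@cvgrPdist_lt _ rat^o) => e e0.
have [k uk] := (Qp_of_eq0 (repr 0)).1 (Qp_of_repr 0) e e0.
exists k => // n /= kn; rewrite sub0r normrN ger0_norm ?padic_abs_ge0 //.
exact: uk.
Qed.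

Lemma Qp_norm_of u : Qp_of u != 0 ->
  0 < Qp_norm (Qp_of u) /\
  exists k, forall n, (k <= n)%N -> abs (u n) = Qp_norm (Qp_of u).
Proof.
move=> /eqP/Qp_of_eq0 nu.
have [c c0 [k uk]] := padic_cauchy_abs (@padic_seq_cauchy u) nu.
have [l ul] := (Qp_of_eq (repr (Qp_of u)) u).1 (Qp_of_repr _) c c0.
suff -> : Qp_norm (Qp_of u) = c by split=> //; exists k.
apply: (@lim_near_cst rat^o); first exact: norm_hausdorff.
exists (maxn k l) => // n /=; rewrite geq_max => /andP[kn ln].
by rewrite -(uk n kn); apply: padic_abs_isosceles; rewrite uk ?ul.
Qed.

Lemma Qp_norm_eventually (x : Qp) : x != 0 -> 0 < Qp_norm x /\ exists k,
  forall n, (k <= n)%N -> abs ((repr x : padic_cauchy_seq) n) = Qp_norm x.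
Proof. by rewrite -{1 2 4}(Qp_of_repr x); exact: Qp_norm_of. Qed.

Lemma Qp_norm_gt0 x : (0 < Qp_norm x) = (x != 0).
Proof.
by have [->|/Qp_norm_eventually[]//] := eqVneq x 0; rewrite Qp_norm0 ltxx.
Qed.

Lemma Qp_norm_ge0 x : 0 <= Qp_norm x.
Proof.
by have [->|] := eqVneq x 0; [rewrite Qp_norm0|rewrite -Qp_norm_gt0 => /ltW].
Qed.

Lemma Qp_norm_eq0 x : (Qp_norm x == 0) = (x == 0).
Proof. by apply: negb_inj; rewrite -(Qp_norm_gt0 x) lt0r Qp_norm_ge0 andbT. Qed.

Lemma Qp_normM x y : Qp_norm (x * y) = Qp_norm x * Qp_norm y.
Proof.
have [->|x0] := eqVneq x 0; first by rewrite !(mul0r, Qp_norm0).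
have [->|y0] := eqVneq y 0; first by rewrite !(mulr0, Qp_norm0).
have [_ [k xk]] := Qp_norm_eventually x0.
have [_ [l yl]] := Qp_norm_eventually y0.
have := @Qp_norm_of (repr x * repr y).
rewrite Qp_ofM !Qp_of_repr mulf_neq0 // => /(_ isT)[_ [m xym]].
pose n := maxn m (maxn k l).
rewrite -(xym n) ?leq_maxl // -(xk n) -?(yl n).
- by rewrite -padic_absM.
- by rewrite !leq_max leqnn !orbT.
- by rewrite !leq_max leqnn !orbT.
Qed.

Lemma Qp_normD x y : Qp_norm (x + y) <= Num.max (Qp_norm x) (Qp_norm y).
Proof.
have [->|x0] := eqVneq x 0; first by rewrite add0r le_max lexx orbT.
have [->|y0] := eqVneq y 0; first by rewrite addr0 le_max lexx.
have [->|xy0] := eqVneq (x + y) 0; first by rewrite Qp_norm0 le_max Qp_norm_ge0.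
have [_ [k xk]] := Qp_norm_eventually x0.
have [_ [l yl]] := Qp_norm_eventually y0.
have := @Qp_norm_of (repr x + repr y).
rewrite Qp_ofD !Qp_of_repr xy0 => /(_ isT)[_ [m xym]].
pose n := maxn m (maxn k l).
rewrite -(xym n) ?leq_maxl // -(xk n) -?(yl n).
- exact: padic_absD.
- by rewrite !leq_max leqnn !orbT.
- by rewrite !leq_max leqnn !orbT.
Qed.

Lemma Qp_normN x : Qp_norm (- x) = Qp_norm x.
Proof.
have [->|x0] := eqVneq x 0; first by rewrite oppr0.
have [_ [k xk]] := Qp_norm_eventually x0.
have := @Qp_norm_of (- repr x).
rewrite Qp_ofN !Qp_of_repr oppr_eq0 x0 => /(_ isT)[_ [m xm]].
rewrite -(xm (maxn k m)) ?leq_maxr // -(xk (maxn k m)) ?leq_maxl //.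
exact: padic_absN.
Qed.

Lemma padic_cauchy_cst (q : rat) : (fun=> q) \in padic_cauchyb p_pr.
Proof.
rewrite unfold_in; apply/asboolP => e e0; exists 0%N => m n _ _.
by rewrite subrr padic_abs0.
Qed.

Lemma ratr_Qp (q : rat) : ratr q = Qp_of (PadicCauchySeq (padic_cauchy_cst q)).
Proof.
pose f q := Qp_of (PadicCauchySeq (padic_cauchy_cst q)).
have fB : zmod_morphism f.
  move=> x y; rewrite /f -Qp_ofN -Qp_ofD; congr Qp_of; exact: val_inj.
have fM : monoid_morphism f.
  split=> [|x y]; rewrite /f -?Qp_of1 -?Qp_ofM; congr Qp_of; exact: val_inj.
pose fa := GRing.isZmodMorphism.Build _ _ f fB.
pose fm := GRing.isMonoidMorphism.Build _ _ f fM.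
pose F : {rmorphism rat -> Qp} := HB.pack f fa fm.
by rewrite -[RHS]/(F q) fmorph_eq_rat.
Qed.

Lemma Qp_norm_ratr (q : rat) : Qp_norm (ratr q) = abs q.
Proof.
have [->|q0] := eqVneq q 0; first by rewrite /ratr mul0r Qp_norm0 padic_abs0.
rewrite ratr_Qp; set u := PadicCauchySeq _.
have /Qp_norm_of[_ [k /(_ k (leqnn k))]//] : Qp_of u != 0.
apply/eqP => /Qp_of_eq0/(_ (abs q)); rewrite padic_abs_gt0 // q0.
by move=> /(_ isT)[k /(_ k (leqnn k))]; rewrite ltxx.
Qed.

Lemma Qp_dense (x : Qp) (e : rat) : 0 < e ->
  exists q : rat, Qp_norm (x - ratr q) < e.
Proof.
move=> e0; have [k uk] := @padic_seq_cauchy (repr x) e e0.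
pose q := (repr x : padic_cauchy_seq) k; exists q.
have [->|] := eqVneq (x - ratr q) 0; first by rewrite Qp_norm0.
rewrite ratr_Qp -{1 2}(Qp_of_repr x) -Qp_ofN -Qp_ofD.
move=> /Qp_norm_of[_ [l /(_ _ (leq_maxr k l)) <-]].
by apply: uk => //; exact: leq_maxl.
Qed.

Definition Qp_dist (x y : Qp) : rat := Qp_norm (x - y).

Lemma Qp_distxx x : Qp_dist x x = 0.
Proof. by rewrite /Qp_dist subrr Qp_norm0. Qed.

Lemma Qp_dist_positivity x y : Qp_dist x y = 0 -> x = y.
Proof. by move=> /eqP; rewrite Qp_norm_eq0 subr_eq0 => /eqP. Qed.

Lemma Qp_dist_sym x y : Qp_dist x y = Qp_dist y x.
Proof. by rewrite /Qp_dist -Qp_normN opprB. Qed.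

Lemma Qp_dist_triangle y x z : Qp_dist x z <= Qp_dist x y + Qp_dist y z.
Proof.
rewrite /Qp_dist -(subrKA y x) (le_trans (Qp_normD _ _)) //.
by rewrite ge_max lerDl lerDr !Qp_norm_ge0.
Qed.

HB.instance Definition _ := isMetric.Build rat Qp
  Qp_distxx Qp_dist_positivity Qp_dist_sym Qp_dist_triangle.
HB.instance Definition _ := isPointed.Build Qp 0.

End padic_cauchy.

Definition borel (T : ptopologicalType) := g_sigma_algebraType (@open T).

(* A Haar measure on the group (T, add). No regularity is required: it is
   automatic on second countable locally compact groups such as those used
   below. *)
Definition is_haar (R : realType) (T : ptopologicalType) (add : T -> T -> T)
    (mu : {measure set (borel T) -> \bar R}) : Prop :=
  [/\ forall (x : T) (A : set T), (@open T).-sigma.-measurable A ->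
        mu [set add x y | y in A] = mu A,
      forall K : set T, compact K -> (mu K < +oo)%E &
      forall U : set T, open U -> U !=set0 -> (0 < mu U)%E].

Section complex_integral.
Context d (T : measurableType d) (R : realType).
Variable mu : {measure set T -> \bar R}.

Definition cintegral (f : T -> R[i]) : R[i] :=
  ((\int[mu]_x complex.Re (f x))%R +i* (\int[mu]_x complex.Im (f x))%R)%C.

End complex_integral.

Section local_density.
Variables (R : realType) (p : nat) (p_pr : prime p).
Local Notation Qp := (Qp p_pr).

Definition padic_int : set Qp := [set x | Qp_norm x <= 1].

Definition Zinvp : set rat :=
  [set y | exists (m : int) (k : nat), y = m%:~R / p%:R ^+ k].

(* y exists, and two choices of it differ by an element of Z[1/p] lying in
   Z_p, i.e. by an integer, so the value does not depend on the choice. *)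
Definition ep (z : Qp) : R[i] :=
  let y := xget 0 [set y : rat | Zinvp y /\ padic_int (z - ratr y)] in
  let t : R := - (2 * pi * ratr y) in (cos t +i* sin t)%C.

Variable V : vectType rat.
Local Notation e := (vbasis {:V}).

(* V (x) Q_p, in coordinates with respect to the basis (e_i (x) 1)_i. *)
Definition Vp := 'rV[Qp]_(\dim {:V}).

Definition toVp (v : V) : Vp := \row_i ratr (coord e i v).

(* The Q_p-bilinear extension of b. *)
Definition bp (b : V -> V -> rat) (w w' : Vp) : Qp :=
  \sum_i \sum_j w 0 i * w' 0 j * ratr (b e`_i e`_j).

Definition phip (b : V -> V -> rat) (w : Vp) : Qp := bp b w w.

(* L (x) Z_p, as the Z_p-submodule of V (x) Q_p spanned by L. *)
Definition Lp (L : set V) : set Vp :=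
  [set w | exists (m : nat) (l : 'I_m -> V) (z : 'I_m -> Qp),
    [/\ forall i, L (l i), forall i, padic_int (z i) & w = \sum_i z i *: toVp (l i)]].

Definition Xp (L : set V) (nu : V) : set Vp := [set w + toVp nu | w in Lp L].

Definition lambdap (L : set V) (nu : V) : Vp -> R[i] :=
  fun w => (\1_(Xp L nu) w : R)%:C%C.

Definition haar_Qp (mu : {measure set (borel Qp) -> \bar R}) :=
  is_haar (fun x y : Qp => x + y) mu.

Definition haar_Vp (mu : {measure set (borel Vp) -> \bar R}) :=
  is_haar (fun x y : Vp => x + y) mu.

Definition local_density (dv : {measure set (borel Vp) -> \bar R})
    (dsigma : {measure set (borel Qp) -> \bar R})
    (b : V -> V -> rat) (lambda : Vp -> R[i]) (h : rat) : R[i] :=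
  cintegral dsigma (fun sigma : Qp =>
    cintegral dv (fun v : Vp => ep (sigma * (phip b v - ratr h)) * lambda v)).

End local_density.

Arguments padic_int {p} p_pr.
Arguments toVp {p} p_pr {V} v.
Arguments Lp {p} p_pr {V} L.
Arguments lambdap R {p} p_pr {V} L nu.

Definition zlattice (V : vectType rat) (n : nat) (v : n.-tuple V) : set V :=
  [set x | exists z : 'I_n -> int, x = \sum_i (tnth v i) *~ z i].

(* Main.v *)
(** Write k = ord_p N. For w = z + nu in X_p and sigma = t N, the hypothesis on
    h makes N (phi(w) - h) a p-adic integer, so for t in Z_p the inner integrand
    is the indicator of X_p and the inner integral is 1. If t is not in Z_p,
    choose i with p not dividing a_i and translate w by (1/(p t)) v_i: this
    preserves X_p and, because p divides N, multiplies the integrand by the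
    constant e_p(- 2 a_i c / p), which is not 1 as p is odd and prime to c. By
    translation invariance the inner integral vanishes. Hence
    b_p = dsigma(N Z_p) = p^-k. *)

Require Import Defs.
From HB Require Import structures.
From mathcomp Require Import all_boot all_order all_algebra.
From mathcomp Require Import all_classical all_reals all_analysis.
From mathcomp Require Import measurable_realfun complex ring.

Set Implicit Arguments.
Unset Strict Implicit.
Unset Printing Implicit Defensive.

Import Order.TTheory GRing.Theory Num.Theory.

Local Open Scope classical_set_scope.
Local Open Scope ring_scope.

(** * Arithmetic of Q_p: the norm, Z_p and Z[1/p] *)

Section padic_field.
Variables (p : nat) (p_pr : prime p).
Local Notation Qp := (Qp p_pr).
Local Notation Zp := (padic_int p_pr).
Local Notation abs := (padic_abs p).

Let p_gt0 : 0 < p%:R :> rat. Proof. by rewrite ltr0n prime_gt0. Qed.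
Let p_gt1 : 1 < p%:R :> rat. Proof. by rewrite ltr1n prime_gt1. Qed.

(** [ratr] into Q_p sends q to the class of the constant sequence q, and this map is visibly a ring
    morphism. The rules for [ratr] below are transferred from it. *)
Lemma ratr_QpE : exists f : {rmorphism rat -> Qp}, forall q, ratr q = f q.
Proof.
pose f q : Qp := Qp_of (PadicCauchySeq (padic_cauchy_cst p_pr q)).
have fB : zmod_morphism f.
  move=> x y; rewrite /f -Qp_ofN -Qp_ofD; congr Qp_of; exact: val_inj.
have fM : monoid_morphism f.
  split=> [|x y]; rewrite /f -?Qp_of1 -?Qp_ofM; congr Qp_of; exact: val_inj.
pose fa := GRing.isZmodMorphism.Build _ _ f fB.
pose fm := GRing.isMonoidMorphism.Build _ _ f fM.
pose F : {rmorphism rat -> Qp} := HB.pack f fa fm.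
by exists F => q; rewrite ratr_Qp.
Qed.

Lemma ratr_QpD x y : ratr (x + y) = ratr x + ratr y :> Qp.
Proof. by have [f E] := ratr_QpE; rewrite !E rmorphD. Qed.

Lemma ratr_QpN x : ratr (- x) = - ratr x :> Qp.
Proof. by have [f E] := ratr_QpE; rewrite !E rmorphN. Qed.

Lemma ratr_QpB x y : ratr (x - y) = ratr x - ratr y :> Qp.
Proof. by have [f E] := ratr_QpE; rewrite !E rmorphB. Qed.

Lemma ratr_QpM x y : ratr (x * y) = ratr x * ratr y :> Qp.
Proof. by have [f E] := ratr_QpE; rewrite !E rmorphM. Qed.

Lemma ratr_QpV x : ratr x^-1 = (ratr x)^-1 :> Qp.
Proof. by have [f E] := ratr_QpE; rewrite !E fmorphV. Qed.

Lemma ratr_Qp_sum I (r : seq I) (P : pred I) (F : I -> rat) :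
  ratr (\sum_(i <- r | P i) F i) = \sum_(i <- r | P i) ratr (F i) :> Qp.
Proof.
by have [f E] := ratr_QpE; rewrite E rmorph_sum; apply: eq_bigr => i; rewrite E.
Qed.

Lemma ratr_Qp_int (m : int) : ratr m%:~R = m%:~R :> Qp.
Proof. by have [f E] := ratr_QpE; rewrite E rmorph_int. Qed.

Lemma ratr_Qp_nat (m : nat) : ratr m%:R = m%:R :> Qp.
Proof. by have [f E] := ratr_QpE; rewrite E rmorph_nat. Qed.

Lemma ratr_Qp_eq0 x : (ratr x == 0 :> Qp) = (x == 0).
Proof. by have [f E] := ratr_QpE; rewrite E fmorph_eq0. Qed.

Lemma natr_Qp_eq0 (m : nat) : (m%:R == 0 :> Qp) = (m == 0)%N.
Proof. by rewrite -ratr_Qp_nat ratr_Qp_eq0 pnatr_eq0. Qed.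

Lemma Qp_norm1 : Qp_norm (1 : Qp) = 1.
Proof. by rewrite -[1]/(1%:R) -ratr_Qp_nat Qp_norm_ratr padic_abs1. Qed.

Lemma Qp_normV (x : Qp) : Qp_norm x^-1 = (Qp_norm x)^-1.
Proof.
have [->|x0] := eqVneq x 0; first by rewrite !(invr0, Qp_norm0).
have nx0 : Qp_norm x != 0 by rewrite Qp_norm_eq0.
by apply: (mulIf nx0); rewrite -Qp_normM !mulVf // Qp_norm1.
Qed.

Lemma padic_intD x y : Zp x -> Zp y -> Zp (x + y).
Proof.
move=> x1 y1; rewrite /padic_int /= (le_trans (Qp_normD _ _)) //.
by rewrite ge_max; apply/andP.
Qed.

Lemma padic_intN x : Zp x -> Zp (- x).
Proof. by rewrite /padic_int /= Qp_normN. Qed.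

Lemma padic_intB x y : Zp x -> Zp y -> Zp (x - y).
Proof. by move=> x1 /padic_intN; exact: padic_intD. Qed.

Lemma padic_intM x y : Zp x -> Zp y -> Zp (x * y).
Proof. by move=> x1 y1; rewrite /padic_int /= Qp_normM mulr_ile1 ?Qp_norm_ge0. Qed.

Lemma padic_int_int (m : int) : Zp m%:~R.
Proof. by rewrite /padic_int /= -ratr_Qp_int Qp_norm_ratr padic_abs_int_le1. Qed.

Lemma padic_int_nat (m : nat) : Zp m%:R.
Proof. exact: (padic_int_int m). Qed.

Lemma padic_int0 : Zp 0. Proof. exact: (padic_int_nat 0). Qed.

Lemma padic_int_sum I (r : seq I) (P : pred I) (F : I -> Qp) :
  (forall i, P i -> Zp (F i)) -> Zp (\sum_(i <- r | P i) F i).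
Proof.
move=> FZ; apply: (big_ind (fun x => Zp x)) => //.
- exact: padic_int0.
- exact: padic_intD.
Qed.

Lemma padic_abs_nat (m : nat) : (0 < m)%N -> abs m%:R = p%:R ^- logn p m.
Proof.
move=> m0; rewrite /padic_abs pnatr_eq0 (gtn_eqF m0) -[m%:R]divr1.
rewrite -[m%:R]/(m%:Z%:~R) -[1]/(1%:~R) padic_valE //.
  by rewrite logn1 subr0 -exprnN.
by rewrite eqz_nat -lt0n.
Qed.

Lemma padic_abs_int (m : int) : abs m%:~R = abs `|m|%:R.
Proof.
case: (leP 0 m) => m0; first by rewrite -{1}(gez0_abs m0).
by rewrite -[m in LHS]opprK -(ltz0_abs m0) intrN padic_absN.
Qed.

Lemma padic_abs_unit (m : nat) : coprime p m -> abs m%:R = 1.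
Proof.
move=> cpm; have m0 : (0 < m)%N.
  rewrite lt0n; apply: contraTneq cpm => ->.
  by rewrite /coprime gcdn0 neq_ltn prime_gt1 // orbT.
rewrite padic_abs_nat // [logn _ _]lognE m0 p_pr /=.
by have := cpm; rewrite prime_coprime // => /negPf ->; rewrite expr0 invr1.
Qed.

Lemma Qp_norm_nat (m : nat) : (0 < m)%N -> Qp_norm (m%:R : Qp) = p%:R ^- logn p m.
Proof. by move=> m0; rewrite -ratr_Qp_nat Qp_norm_ratr padic_abs_nat. Qed.

Lemma padic_unit_nat (m : nat) : coprime p m -> Qp_norm (m%:R : Qp) = 1.
Proof. by move=> m0; rewrite -ratr_Qp_nat Qp_norm_ratr padic_abs_unit. Qed.

Lemma Qp_norm_p : Qp_norm (p%:R : Qp) = p%:R^-1.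
Proof. by rewrite Qp_norm_nat ?prime_gt0 // logn_prime // eqxx. Qed.

(** The value group is discrete: the norm of a nonzero x is the p-adic absolute value of a rational,
    hence an integral power of p, so a norm below 1 is at most 1/p. *)
Lemma padic_int_divp (x : Qp) : Qp_norm x < 1 -> Zp (x / p%:R).
Proof.
have [->|x0] := eqVneq x 0; first by rewrite mul0r => _; exact: padic_int0.
have [nx0 [k /(_ k (leqnn k))]] := Qp_norm_eventually x0.
set q := (X in abs X) => qE; rewrite /padic_int /= Qp_normM Qp_normV Qp_norm_p invrK.
have q0 : q != 0 by rewrite -(padic_abs_gt0 p_pr) qE.
rewrite -qE /padic_abs (negPf q0) -[1]/(p%:R ^ 0) ltr_eXz2l // => v0.
rewrite -[X in _ * X]/(p%:R ^ 1) -expfzDr ?gt_eqF // -[1 in leRHS]/(p%:R ^ 0).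
by rewrite ler_eXz2l // lezD1.
Qed.

(** The intersection of Z[1/p] with Z_p is Z: for y = m / p^k the bound says k <= ord_p m, so p^k
    divides m. *)
Lemma Zinvp_int (y : rat) : Zinvp p y -> abs y <= 1 -> exists m : int, y = m%:~R.
Proof.
move=> [m [k ->]]; have [->|m0] := eqVneq m 0; first by exists 0; rewrite mul0r.
rewrite padic_absM // padic_absV // -natrX padic_abs_int.
rewrite [X in X * _]padic_abs_nat ?absz_gt0 //.
rewrite padic_abs_nat ?expn_gt0 ?prime_gt0 // pfactorK // invrK.
rewrite ler_pdivrMl ?exprn_gt0 // mulr1 ler_eXn2l // => km.
have /dvdnP[d dE] : (p ^ k %| `|m|)%N by rewrite pfactor_dvdn // absz_gt0.
exists ((-1) ^+ (m < 0)%R * d%:Z).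
rewrite {1}(intEsign m) dE PoszM mulrA intrM -[((p ^ k)%:Z)%:~R]/((p ^ k)%:R).
by rewrite mulfK // pnatr_eq0 -lt0n expn_gt0 prime_gt0.
Qed.

(** Partial fractions: if the denominator is d' p^k with d' prime to p, and u p^k + w d' = 1, then q
    is the sum of [numq q] * w / p^k and of [numq q] * u / d', which is p-integral. *)
Lemma Zinvp_approx_rat (q : rat) : exists2 y, Zinvp p y & abs (q - y) <= 1.
Proof.
have d0 : (0 < `|denq q|)%N by rewrite absz_gt0 denq_neq0.
have [d' cpd dE] := pfactor_coprime p_pr d0.
set k := logn _ _ in dE.
have : coprimez (p ^ k)%N d' by rewrite coprimezE !absz_nat coprimeXl.
move=> /coprimezP[[u w] /= uw].
have d'0 : d'%:R != 0 :> rat.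
  by rewrite pnatr_eq0; apply: contraTneq d0 => d'0; rewrite dE d'0.
have pk0 : p%:R ^+ k != 0 :> rat by rewrite expf_neq0 // gt_eqF.
exists ((numq q * w)%:~R / p%:R ^+ k); first by exists (numq q * w), k.
have -> : q - (numq q * w)%:~R / p%:R ^+ k = (numq q * u)%:~R / d'%:R.
  rewrite -{1}[q]divq_num_den -[denq q]gez0_abs ?denq_ge0 // dE.
  rewrite -[(_%:Z)%:~R]/(_%:R) natrM natrX !intrM.
  have /(congr1 (fun z : int => z%:~R : rat)) := uw.
  rewrite intrD !intrM -!pmulrn natrX => E.
  have {E}-> : u%:~R = (1 - w%:~R * d'%:R) / p%:R ^+ k :> rat.
    by apply: canRL (mulfK pk0) _; exact: canRL (addrK _) E.
  by field; rewrite d'0 pk0.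
rewrite padic_absM // padic_absV // (padic_abs_unit cpd) invr1 mulr1.
exact: padic_abs_int_le1.
Qed.

(** Q_p = Z[1/p] + Z_p, from the rational case by density. This is what makes [ep] meaningful. *)
Lemma Zinvp_approx (x : Qp) : exists2 y, Zinvp p y & Zp (x - ratr y).
Proof.
have [q xq] := Qp_dense x ltr01.
have [y yZ qy] := Zinvp_approx_rat q; exists y => //.
rewrite -(subrKA (ratr q)); apply: padic_intD; first exact: ltW.
by rewrite -ratr_QpB /padic_int /= Qp_norm_ratr.
Qed.

Lemma ZinvpB x y : Zinvp p x -> Zinvp p y -> Zinvp p (x - y).
Proof.
move=> [m [k ->]] [m' [k' ->]].
exists (m * (p ^ k')%:Z - m' * (p ^ k)%:Z), (k + k')%N.
rewrite intrB !intrM -!pmulrn !natrX exprD.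
by field; rewrite !expf_neq0 // gt_eqF.
Qed.

Lemma ZinvpD x y : Zinvp p x -> Zinvp p y -> Zinvp p (x + y).
Proof.
move=> xZ yZ; rewrite -[y]opprK; apply: ZinvpB => //.
rewrite -[- y]add0r; apply: ZinvpB => //.
by exists 0, 0%N; rewrite mul0r.
Qed.

(** Approximate x / p^k by y in Z[1/p]. Then p^k y lies in both Z[1/p] and Z_p, so it is an integer
    m, and i is its residue modulo p^k. *)
Lemma padic_int_residue (k : nat) (x : Qp) : Zp x ->
  exists2 i, (i < p ^ k)%N & Zp ((x - i%:R) / p%:R ^+ k).
Proof.
move=> xZ; have [y yZ xy] := Zinvp_approx (x / p%:R ^+ k).
have pk0 : p%:R ^+ k != 0 :> Qp by rewrite expf_neq0 // natr_Qp_eq0 -lt0n prime_gt0.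
have [m mE] : exists m : int, p%:R ^+ k * y = m%:~R.
  apply: Zinvp_int.
    have [u [l ->]] := yZ; exists ((p ^ k)%:Z * u), l.
    by rewrite intrM -pmulrn natrX mulrA.
  rewrite -(Qp_norm_ratr p_pr) ratr_QpM -natrX ratr_Qp_nat.
  have -> : (p ^ k)%:R * ratr y = x - p%:R ^+ k * (x / p%:R ^+ k - ratr y).
    have aux (F : fieldType) (a b c : F) : c != 0 -> c * b = a - c * (a / c - b).
      by move=> c0; field.
    by rewrite natrX; exact: aux.
  by apply: padic_intB => //; apply: padic_intM => //; rewrite -natrX; exact: padic_int_nat.
have pkZ : (p ^ k)%:Z != 0 by rewrite eqz_nat -lt0n expn_gt0 prime_gt0.
exists `|(m %% (p ^ k)%:Z)%Z|%N.
  by rewrite -ltz_nat gez0_abs ?modz_ge0 // ltz_pmod // ltz_nat expn_gt0 prime_gt0.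
set i := `|_|%N.
have iE : i%:R = m%:~R - (m %/ (p ^ k)%:Z)%Z%:~R * p%:R ^+ k :> Qp.
  rewrite pmulrn /i gez0_abs ?modz_ge0 // /modz intrB intrM.
  by rewrite -pmulrn natrX.
have -> : (x - i%:R) / p%:R ^+ k =
    (x / p%:R ^+ k - ratr y) + (m %/ (p ^ k)%:Z)%Z%:~R.
  rewrite iE -(ratr_Qp_int m) -mE -natrX ratr_QpM ratr_Qp_nat natrX.
  have aux (F : fieldType) (a b c d : F) : c != 0 ->
      (a - (c * b - d * c)) / c = a / c - b + d by move=> c0; field.
  exact: aux.
by apply: padic_intD => //; exact: padic_int_int.
Qed.

(** The quotient is in Z[1/p] and in Z_p, hence an integer, so i and j are congruent modulo p^k and
    both already reduced. *)
Lemma padic_int_residue_inj (k i j : nat) : (i < p ^ k)%N -> (j < p ^ k)%N ->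
  Zp ((i%:R - j%:R) / p%:R ^+ k) -> i = j.
Proof.
move=> ik jk; have -> : (i%:R - j%:R) / p%:R ^+ k =
    ratr ((i%:Z - j%:Z)%:~R / p%:R ^+ k) :> Qp.
  by rewrite ratr_QpM ratr_QpV ratr_Qp_int intrB -[X in ratr X]natrX ratr_Qp_nat natrX.
rewrite /padic_int /= Qp_norm_ratr => /Zinvp_int[|m].
  by exists (i%:Z - j%:Z), k.
have pk0 : p%:R ^+ k != 0 :> rat by rewrite expf_neq0 // gt_eqF.
move=> /(congr1 ( *%R^~ (p%:R ^+ k))); rewrite divfK // -natrX.
rewrite [X in _ * X]pmulrn -intrM => /intr_inj/eqP.
rewrite subr_eq => /eqP E.
have := congr1 (fun z => (z %% (p ^ k)%:Z)%Z) E.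
rewrite /= modzMDl !modz_small ?ltz_nat //.
by case.
Qed.
End padic_field.

(** * The additive character of Q_p *)

Section additive_character.
Variable R : realType.

(* The standard additive character of R; ep is its pullback along
   Q_p / Z_p = Z[1/p] / Z. *)
Definition e_inf (t : R) : R[i] :=
  (cos (- (2 * pi * t)) +i* sin (- (2 * pi * t)))%C.

Lemma e_infD s t : e_inf (s + t) = e_inf s * e_inf t.
Proof.
rewrite /e_inf mulrDr opprD cosD sinD; apply/eqP; rewrite eq_complex /=.
by rewrite eqxx /= addrC.
Qed.

Lemma e_inf0 : e_inf 0 = 1.
Proof. by rewrite /e_inf mulr0 oppr0 cos0 sin0. Qed.

Lemma e_infN t : e_inf (- t) * e_inf t = 1.
Proof. by rewrite -e_infD addNr e_inf0. Qed.

Lemma e_inf_nat (m : nat) : e_inf m%:R = 1.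
Proof.
elim: m => [|m IH]; first exact: e_inf0.
rewrite -natr1 e_infD IH mul1r /e_inf mulr1 mulr_natl cosN sinN cos2pi sin2pi.
by rewrite oppr0.
Qed.

Lemma e_inf_int (m : int) : e_inf m%:~R = 1.
Proof.
case: m => m; first exact: e_inf_nat.
by have := e_infN m.+1%:R; rewrite e_inf_nat mulr1 NegzE intrN.
Qed.

(** For the fractional part f of t, the real part gives 1 - 2 sin(pi f)^2 = 1, while sin(pi f) > 0
    as soon as 0 < f < 1. *)
Lemma e_inf_eq1 t : e_inf t = 1 -> exists m : int, t = m%:~R.
Proof.
move=> t1; exists (Num.floor t); apply/eqP; rewrite -subr_eq0.
set f := t - _.
have f1 : e_inf f = 1 by rewrite e_infD t1 -intrN e_inf_int mulr1.
have f_ge0 : 0 <= f by rewrite subr_ge0 floor_le.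
have f_lt1 : f < 1 by rewrite ltrBlDl -intrD1 floorD1_gt.
move: f_ge0; rewrite le_eqVlt eq_sym => /orP[//|f_gt0].
have /(congr1 (@complex.Re R)) := f1.
rewrite /= cosN -mulrA mulr_natl cos_mulr2n.
have sin_neq0 : sin (pi * f) != 0.
  rewrite gt_eqF // sin_gt0_pi // mulr_gt0 ?pi_gt0 //=.
  by rewrite -[ltRHS]mulr1 ltr_pM2l ?pi_gt0.
have := cos2Dsin2 (pi * f) => /(canRL (addrK _)) ->.
rewrite mulrnBl -[X in X - _ - _](@natr1 R 1) addrAC addrK => /eqP.
by rewrite -subr_eq0 addrAC subrr add0r oppr_eq0 mulrn_eq0 sqrf_eq0 (negPf sin_neq0).
Qed.

Lemma e_inf_Re_le1 t : `|complex.Re (e_inf t)| <= 1.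
Proof. by rewrite ler_norml cos_geN1 cos_le1. Qed.

Lemma e_inf_Im_le1 t : `|complex.Im (e_inf t)| <= 1.
Proof. by rewrite ler_norml sin_geN1 sin_le1. Qed.

Variables (p : nat) (p_pr : prime p).
Local Notation Qp := (Qp p_pr).
Local Notation Zp := (padic_int p_pr).
Local Notation ep := (@ep R p p_pr).

(** Since Q_p = Z[1/p] + Z_p, the default value of [xget] in [ep] is never reached. *)
Lemma epP (z : Qp) : exists y, [/\ Zinvp p y, Zp (z - ratr y) & ep z = e_inf (ratr y)].
Proof.
rewrite /ep; case: xgetP => [y _ [yZ zy]|nz]; first by exists y.
by have [y yZ zy] := Zinvp_approx z; have := nz y; case.
Qed.

(** Two representatives in Z[1/p] of the same class modulo Z_p differ by an integer, which [e_inf]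
    does not see. *)
Lemma e_inf_Zinvp (x y : rat) : Zinvp p x -> Zinvp p y -> Zp (ratr x - ratr y) ->
  e_inf (ratr x) = e_inf (ratr y).
Proof.
move=> xZ yZ; rewrite -ratr_QpB /padic_int /= Qp_norm_ratr => xy.
have [m mE] := Zinvp_int p_pr (ZinvpB p_pr xZ yZ) xy.
by rewrite -(subrK y x) rmorphD /= e_infD mE ratr_int e_inf_int mul1r.
Qed.

Lemma epD (z w : Qp) : ep (z + w) = ep z * ep w.
Proof.
have [y [yZ zy ->]] := epP z; have [y' [yZ' zy' ->]] := epP w.
have [y2 [yZ2 zy2 ->]] := epP (z + w).
rewrite -e_infD -rmorphD /=; apply: e_inf_Zinvp => //; first exact: ZinvpD.
have := padic_intB (padic_intD zy zy') zy2.
have aux (F : comNzRingType) (a b c d e : F) :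
    a - c + (b - d) - (a + b - e) = e - (c + d) by ring.
by rewrite aux -ratr_QpD.
Qed.

(** The kernel of the character is exactly Z_p. One inclusion trivializes integral phases; the other
    shows that the multiplier of a suitable translation is not 1. *)
Lemma ep_eq1 (z : Qp) : ep z = 1 <-> Zp z.
Proof.
have [y [yZ zy ->]] := epP z; split.
  move=> /e_inf_eq1[m]; rewrite -(ratr_int R) => /fmorph_inj yE.
  by rewrite -(subrK (ratr y) z); apply: padic_intD => //; rewrite yE ratr_Qp_int; exact: padic_int_int.
move=> zZ; rewrite -e_inf0 -(rmorph0 (@ratr R)).
apply: e_inf_Zinvp => //; first by exists 0, 0%N; rewrite mul0r.
by have := padic_intB zZ zy; rewrite opprB addrC subrK -ratr_QpB subr0.
Qed.

Lemma ep_int (z : Qp) : Zp z -> ep z = 1. Proof. by move=> /ep_eq1. Qed.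

Lemma ep_Re_le1 (z : Qp) : `|complex.Re (ep z)| <= 1.
Proof. exact: e_inf_Re_le1. Qed.

Lemma ep_Im_le1 (z : Qp) : `|complex.Im (ep z)| <= 1.
Proof. exact: e_inf_Im_le1. Qed.

End additive_character.

(** * Integrals of complex-valued functions *)

Section complex_integral_theory.
Context (d : measure_display) (T : measurableType d) (R : realType).
Variable mu : {measure set T -> \bar R}.

Lemma le_indic_integrable (A : set T) (F : T -> R) :
  measurable A -> (mu A < +oo)%E -> measurable_fun [set: T] F ->
  (forall x, `|F x| <= \1_A x) -> mu.-integrable [set: T] (EFin \o F).
Proof.
move=> mA Aoo mF FA.
have mI : measurable_fun [set: T] (\1_A : T -> R) by exact: measurable_indic.
have iI : mu.-integrable [set: T] (EFin \o (\1_A : T -> R)).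
  apply/integrableP; split; first exact/measurable_EFinP.
  under eq_integral => x _ do rewrite /= ger0_norm //.
  by rewrite integral_indic // setIT.
apply: le_integrable iI => //; first exact/measurable_EFinP.
by move=> x _ /=; rewrite lee_fin (le_trans (FA x)) // ler_norm.
Qed.

(** Invariance of [mu] under [g] gives I = z I for the integral I, so (1 - z) I = 0. The identity is
    checked on real and imaginary parts, through which [cintegral] is defined. *)
Lemma cintegral_comp_eq0 (g : T -> T) (f : T -> R[i]) (z : R[i]) :
  measurable_fun [set: T] g ->
  (forall A, measurable A -> mu (g @^-1` A) = mu A) ->
  mu.-integrable [set: T] (EFin \o (fun x => complex.Re (f x))) ->
  mu.-integrable [set: T] (EFin \o (fun x => complex.Im (f x))) ->
  (forall x, f (g x) = z * f x) -> z != 1 -> cintegral mu f = 0.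
Proof.
move=> mg gmu iRe iIm fg z1.
set a := complex.Re z; set b := complex.Im z.
have ReE x : complex.Re (f (g x)) = a * complex.Re (f x) - b * complex.Im (f x).
  by rewrite fg /a /b; case: (z) => ? ?; case: (f x).
have ImE x : complex.Im (f (g x)) = a * complex.Im (f x) + b * complex.Re (f x).
  by rewrite fg /a /b; case: (z) => ? ?; case: (f x).
(* Change of variables: by [gmu] the pushforward of [mu] along [g] is [mu] itself. *)
have pf (F : T -> R) : mu.-integrable [set: T] (EFin \o F) ->
    mu.-integrable [set: T] (EFin \o (F \o g)) ->
    \int[mu]_x F (g x) = \int[mu]_x F x.
  move=> iF iFg; rewrite /Rintegral; congr fine.
  have mF : measurable_fun [set: T] (EFin \o F) by case/integrableP: iF.
  have := @integral_pushforward _ _ T T R g mg mu setT (EFin \o F) mF iFg measurableT.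
  rewrite preimage_setT /= => <-.
  by apply: eq_measure_integral => A mA _; exact: gmu.
have iZ (r : R) (F : T -> R) : mu.-integrable [set: T] (EFin \o F) ->
    mu.-integrable [set: T] (EFin \o (fun x => r * F x)).
  by move=> iF; exact: (integrableZl measurableT r iF).
have IRe : \int[mu]_x complex.Re (f x) =
    a * \int[mu]_x complex.Re (f x) - b * \int[mu]_x complex.Im (f x).
  rewrite -{1}(pf (fun x => complex.Re (f x))) //.
    under eq_Rintegral => x _ do rewrite ReE.
    by rewrite RintegralB ?RintegralZl //; exact: iZ.
  rewrite (_ : _ \o _ = EFin \o (fun x => a * complex.Re (f x) - b * complex.Im (f x))).
    exact: (integrableB measurableT (iZ a _ iRe) (iZ b _ iIm)).
  by apply/funext => x /=; rewrite ReE.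
have IIm : \int[mu]_x complex.Im (f x) =
    a * \int[mu]_x complex.Im (f x) + b * \int[mu]_x complex.Re (f x).
  rewrite -{1}(pf (fun x => complex.Im (f x))) //.
    under eq_Rintegral => x _ do rewrite ImE.
    by rewrite RintegralD ?RintegralZl //; exact: iZ.
  rewrite (_ : _ \o _ = EFin \o (fun x => a * complex.Im (f x) + b * complex.Re (f x))).
    exact: (integrableD measurableT (iZ a _ iIm) (iZ b _ iRe)).
  by apply/funext => x /=; rewrite ImE.
have : cintegral mu f = z * cintegral mu f.
  apply/eqP; rewrite eq_complex /cintegral /=; apply/andP; split; apply/eqP.
    by rewrite {1}IRe /a /b; case: (z).
  by rewrite {1}IIm /a /b; case: (z).
move=> /eqP; rewrite -subr_eq0 -{1}[cintegral _ _]mul1r -mulrBl mulf_eq0.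
by rewrite subr_eq0 eq_sym (negPf z1) => /eqP.
Qed.

Lemma cintegral_indic (A : set T) : measurable A ->
  cintegral mu (fun x => (\1_A x : R)%:C%C) = (fine (mu A))%:C%C.
Proof.
move=> mA; rewrite /cintegral /= /Rintegral integral_indic // setIT.
by rewrite integral0.
Qed.

End complex_integral_theory.

(** * Borel measurability and translation invariance *)

Section borel_theory.
Variable (R : realType).

Lemma open_borel (T : ptopologicalType) (A : set T) :
  open A -> measurable (A : set (borel T)).
Proof. by move=> oA; exact: sub_sigma_algebra. Qed.

(** The hypothesis ranges over all sets [A], so it says that [F] is locally constant. *)
Lemma open_preimage_measurable (T : ptopologicalType) (F : T -> R) :
  (forall A, open (F @^-1` A)) -> measurable_fun [set: borel T] (F : borel T -> R).
Proof. by move=> oF _ A mA; rewrite setTI; apply: open_borel; exact: oF. Qed.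

Lemma borel_measurable_fun (T : ptopologicalType) (g : T -> T) :
  (forall A, open A -> open (g @^-1` A)) ->
  measurable_fun [set: borel T] (g : borel T -> borel T).
Proof.
move=> og; apply: (@measurability _ _ (borel T) (borel T) setT g (@open T)) => //.
by move=> _ [A oA <-]; rewrite setTI; apply: open_borel; exact: og.
Qed.

(** The preimage under [add s] is the image under the inverse translation [add s'], to which
    [is_haar] applies. *)
Lemma haar_preimage (T : ptopologicalType) (add : T -> T -> T) (s s' : T)
    (mu : {measure set (borel T) -> \bar R}) (A : set T) :
  is_haar add mu -> cancel (add s) (add s') -> cancel (add s') (add s) ->
  measurable (A : set (borel T)) -> mu (add s @^-1` A) = mu A.
Proof.
move=> [haar _ _] sK s'K mA; rewrite -(haar s' A mA); congr (mu _).
apply/seteqP; split => [x /= sx|_ [x Ax <-] /=]; last by rewrite s'K.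
by exists (add s x).
Qed.

End borel_theory.

(** * Topology of Q_p and the volume of p^k Z_p *)

Section padic_topology.
Variables (p : nat) (p_pr : prime p).
Local Notation Qp := (Qp p_pr).
Local Notation Zp := (padic_int p_pr).

Lemma Qp_ballE (x y : Qp) (e : rat) : ball x e y <-> Qp_norm (y - x) < e.
Proof. by rewrite ballEmdist -Qp_normN opprB. Qed.

Lemma rVQp_openP (n : nat) (A : set 'rV[Qp]_n) : open A <->
  forall x, A x -> exists2 e : rat, 0 < e &
    forall w : 'rV[Qp]_n, (forall i, Qp_norm (w 0 i) < e) -> A (x + w).
Proof.
rewrite openE; split => oA x Ax.
  have /nbhs_ballP[e e0 eA] := oA x Ax.
  exists e => // w we; apply: eA; split=> // i j.
  by rewrite ord1 Qp_ballE mxE addrAC subrr add0r.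
have [e e0 eA] := oA x Ax; apply/nbhs_ballP; exists e => // y [_ xy].
rewrite -(subrK x y) addrC; apply: eA => i.
by have /Qp_ballE := xy 0 i; rewrite !mxE.
Qed.

Lemma rVQp_translation_open (n : nat) (s : 'rV[Qp]_n) (A : set 'rV[Qp]_n) :
  open A -> open (+%R s @^-1` A).
Proof.
move=> /rVQp_openP oA; apply/rVQp_openP => x /oA[e e0 eA]; exists e => // w /eA.
by rewrite /= addrA.
Qed.

(** By the ultrametric inequality, the ball of radius |c| around any point of the coset x0 + c Z_p
    stays in it. *)
Lemma Qp_ideal_coset_open (c x0 : Qp) : c != 0 -> open [set x | Zp ((x - x0) / c)].
Proof.
move=> c0; rewrite openE => x Ax.
apply/nbhs_ballP; exists (Qp_norm c) => /=; first by rewrite Qp_norm_gt0.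
move=> y /Qp_ballE yx; rewrite /= -(subrKA x) mulrDl; apply: padic_intD => //.
by rewrite /padic_int /= Qp_normM Qp_normV ler_pdivrMr ?Qp_norm_gt0 // mul1r ltW.
Qed.

(** Z_p is the disjoint union of p^k translates of p^k Z_p, all of the same measure, and has measure
    1. *)
Lemma haar_Qp_ideal (R : realType) (mu : {measure set (borel Qp) -> \bar R}) (k : nat) :
  haar_Qp mu -> mu Zp = 1%E ->
  mu [set x : Qp | Zp (x / p%:R ^+ k)] = (p%:R ^- k)%:E.
Proof.
move=> [haar _ _] Z1.
have pk0 : p%:R ^+ k != 0 :> Qp by rewrite expf_neq0 // natr_Qp_eq0 -lt0n prime_gt0.
pose C (i : nat) := [set x : Qp | Zp ((x - i%:R) / p%:R ^+ k)].
(* Padding by empty sets turns the p^k cosets into a disjoint sequence indexed by all of [nat]. *)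
pose F i := if (i < p ^ k)%N then C i else set0.
have mC i : measurable (C i : set (borel Qp)) by apply: open_borel; exact: Qp_ideal_coset_open.
have C0 : [set x : Qp | Zp (x / p%:R ^+ k)] = C 0.
  by apply/seteqP; split => x /=; rewrite /C /= subr0.
have muC i : mu (C i) = mu (C 0%N).
  rewrite -(haar i%:R (C 0%N) (mC 0)); congr (mu _).
  apply/seteqP; split => [x Cx|_ [x Cx <-]]; last first.
    by move: Cx; rewrite /C /= subr0 [_%:R + x]addrC addrK.
  by exists (x - i%:R); [rewrite /C /= subr0|rewrite addrC subrK].
have ZE : Zp = \big[setU/set0]_(i < p ^ k) F i.
  rewrite -bigcup_mkord; apply/seteqP; split => [x xZ|x [i /= ik]].
    by have [i ik xi] := padic_int_residue k xZ; exists i => //; rewrite /F ik.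
  rewrite /F ik => xi; rewrite -(subrK i%:R x); apply: padic_intD.
    rewrite -[X in Zp X](divfK pk0); apply: padic_intM => //.
    by rewrite -natrX; exact: padic_int_nat.
  exact: padic_int_nat.
have tF : trivIset [set: nat] F.
  apply/trivIsetP => i j _ _ ij; rewrite /F.
  case: ifP => [ik|_]; last by rewrite set0I.
  case: ifP => [jk|_]; last by rewrite setI0.
  apply/seteqP; split => // x [xi xj]; apply: (negP ij); apply/eqP.
  apply: (padic_int_residue_inj ik jk).
  by have := padic_intB xj xi; rewrite -mulrBl opprB addrC subrKA.
have mF i : measurable (F i : set (borel Qp)) by rewrite /F; case: ifP.
have Z0 : Zp = [set x : Qp | Zp ((x - 0) / 1)].
  by apply/seteqP; split => x /=; rewrite subr0 divr1.
rewrite C0; have Z1' := Z1; move: Z1; rewrite [X in mu X = _ -> _]ZE measure_bigsetU // (eq_bigr (fun=> mu (C 0%N))); last first.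
  by move=> i _; rewrite /F ltn_ord; exact: muC.
(* Finiteness comes from the inclusion of p^k Z_p in Z_p; it allows the equation to be solved in
   [R]. *)
have /fineK <- : mu (C 0%N) \is a fin_num.
  rewrite ge0_fin_numE // (le_lt_trans _ (ltry 1)) // -Z1' le_measure ?inE //.
    by apply: open_borel; rewrite Z0; exact: Qp_ideal_coset_open (oner_neq0 _).
  by rewrite -C0 => x /= xZ; rewrite -(divfK pk0 x); apply: padic_intM => //;
     rewrite -natrX; exact: padic_int_nat.
rewrite sumEFin sumr_const card_ord => -[] rE.
have pkR : (p ^ k)%:R != 0 :> R by rewrite pnatr_eq0 -lt0n expn_gt0 prime_gt0.
by congr EFin; apply: (mulfI pkR); rewrite mulr_natl rE natrX divff // -natrX.
Qed.

End padic_topology.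

(** * Coordinates with respect to the lattice basis *)

Section lattice_coordinates.
Variables (p : nat) (p_pr : prime p) (V : vectType rat).
Local Notation Qp := (Qp p_pr).
Local Notation Zp := (padic_int p_pr).
Local Notation Vp := (Vp p_pr V).
Local Notation toVp := (toVp p_pr).
Local Notation e := (vbasis {:V}).
Variables (n : nat) (v : n.-tuple V).

(** The Q_p-linear extension of the j-th coordinate in [v]. The entries of [w] refer to the basis
    [e], so this is a change of basis. *)
Definition padic_coord (j : 'I_n) (w : Vp) : Qp :=
  \sum_i w 0 i * ratr (coord v j e`_i).

Lemma padic_coordD j w w' : padic_coord j (w + w') = padic_coord j w + padic_coord j w'.
Proof. by rewrite -big_split; apply: eq_bigr => i _; rewrite mxE mulrDl. Qed.

Lemma padic_coordZ j z w : padic_coord j (z *: w) = z * padic_coord j w.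
Proof. by rewrite mulr_sumr; apply: eq_bigr => i _; rewrite mxE mulrA. Qed.

Lemma padic_coordB j w w' : padic_coord j (w - w') = padic_coord j w - padic_coord j w'.
Proof. by rewrite padic_coordD -scaleN1r padic_coordZ mulN1r. Qed.

Lemma padic_coord_sum j I (r : seq I) (F : I -> Vp) :
  padic_coord j (\sum_(i <- r) F i) = \sum_(i <- r) padic_coord j (F i).
Proof.
elim/big_rec2: _ => [|i x y _ <-]; last by rewrite padic_coordD.
by rewrite -(scale0r (0 : Vp)) padic_coordZ mul0r.
Qed.

Lemma padic_coord_toVp j x : padic_coord j (toVp x) = ratr (coord v j x).
Proof.
rewrite {2}(coord_vbasis (memvf x)) linear_sum ratr_Qp_sum.
by apply: eq_bigr => i _; rewrite mxE linearZ ratr_QpM.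
Qed.

Lemma Qp_norm_sum_lt I (r : seq I) (F : I -> Qp) (d : rat) : 0 < d ->
  (forall i, Qp_norm (F i) < d) -> Qp_norm (\sum_(i <- r) F i) < d.
Proof.
move=> d0 Fd; apply: (big_ind (fun x : Qp => Qp_norm x < d)) => //.
  by rewrite Qp_norm0.
by move=> x y xd yd; rewrite (le_lt_trans (Qp_normD _ _)) // gt_max xd.
Qed.

(** Continuity at 0 of finitely many linear forms: [M] bounds the norms of all entries of the change
    of basis matrix. *)
Lemma padic_coord_small (d : rat) : 0 < d -> exists2 d' : rat, 0 < d' &
  forall w : Vp, (forall i, Qp_norm (w 0 i) < d') ->
  forall j, Qp_norm (padic_coord j w) < d.
Proof.
move=> d0; pose N (i : 'I_(\dim {:V})) j := Qp_norm (ratr (coord v j e`_i) : Qp).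
(* The summand 1 keeps [M] positive even if every entry vanishes. *)
pose M := 1 + \sum_i \sum_j N i j.
have N0 i j : 0 <= N i j by exact: Qp_norm_ge0.
have S0 : 0 <= \sum_i \sum_j N i j by apply: sumr_ge0 => i _; exact: sumr_ge0.
have M0 : 0 < M by rewrite ltr_pwDl.
have NM i j : N i j <= M.
  have le1 (I : finType) (F : I -> rat) k : (forall i, 0 <= F i) -> F k <= \sum_i F i.
    by move=> F0; rewrite (bigD1 k) //= lerDl sumr_ge0.
  apply: le_trans (le1 _ (N i) j (N0 i)) _.
  apply: le_trans (le1 _ (fun i => \sum_j N i j) i _) _; last by rewrite lerDr ler01.
  by move=> k; exact: sumr_ge0.
exists (d / M); first by rewrite divr_gt0.
move=> w wd j; apply: Qp_norm_sum_lt => // i; rewrite Qp_normM -[d](divfK (lt0r_neq0 M0)).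
apply: le_lt_trans (_ : Qp_norm (w 0 i) * M < _).
  by rewrite ler_wpM2l ?Qp_norm_ge0 //; exact: NM.
by rewrite ltr_pM2r.
Qed.

Hypothesis bv : basis_of {:V} v.

Lemma padic_coordK w : w = \sum_j padic_coord j w *: toVp (tnth v j).
Proof.
apply/rowP => i; rewrite summxE.
(* The change of basis matrices from [e] to [v] and back are mutually inverse. *)
have S (k : 'I_(\dim {:V})) :
    \sum_j coord v j e`_k * coord e i (tnth v j) = (k == i)%:R.
  rewrite -(coord_free k i (basis_free (vbasisP _))).
  rewrite [in RHS](coord_basis bv (memvf e`_k)) linear_sum.
  by apply: eq_bigr => j _; rewrite linearZ (tnth_nth 0).
transitivity (\sum_j \sum_k w 0 k * ratr (coord v j e`_k * coord e i (tnth v j)) : Qp);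
    last first.
  apply: eq_bigr => j _; rewrite !mxE mulr_suml; apply: eq_bigr => k _.
  by rewrite ratr_QpM mulrA.
rewrite exchange_big /= (bigD1 i) //= -mulr_sumr -ratr_Qp_sum S eqxx ratr_Qp_nat mulr1.
rewrite big1 ?addr0 // => k ki.
by rewrite -mulr_sumr -ratr_Qp_sum S (negPf ki) ratr_Qp_nat mulr0.
Qed.

(** Lattice vectors have integral coordinates in [v], and so do their Z_p-combinations. Conversely,
    the expansion of [w] in the basis [v] is such a combination. *)
Lemma LpE w : Lp p_pr (zlattice v) w <-> forall j, Zp (padic_coord j w).
Proof.
split=> [[m [l [z [lL zZ ->]]]] j|wZ].
  rewrite padic_coord_sum; apply: padic_int_sum => i _.
  rewrite padic_coordZ padic_coord_toVp; apply: padic_intM => //.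
  have [k ->] := lL i; rewrite (eq_bigr (fun i => (k i)%:~R *: v`_i)); last first.
    by move=> i' _; rewrite scaler_int (tnth_nth 0).
  by rewrite coord_sum_free ?(basis_free bv) // ratr_Qp_int; exact: padic_int_int.
exists n, (tnth v), (padic_coord^~ w); split => //; last exact: padic_coordK.
move=> i; exists (fun j => (i == j)%:Z); rewrite (bigD1 i) //= eqxx mulr1z.
by rewrite big1 ?addr0 // => j ji; rewrite eq_sym (negPf ji) mulr0z.
Qed.

Lemma XpE nu w : Xp (zlattice v) nu w <->
  forall j, Zp (padic_coord j w - ratr (coord v j nu)).
Proof.
split=> [[w' /LpE w'Z <-] j|wZ].
  by rewrite padic_coordD padic_coord_toVp addrK.
exists (w - toVp nu); last by rewrite subrK.
by apply/LpE => j; rewrite padic_coordB padic_coord_toVp.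
Qed.

(** [bp] is defined through the basis [e]: each b(e_i, e_k) is expanded in the coordinates of [v],
    where the Gram matrix is diagonal, and the sum over [v] is moved outside. *)
Lemma phip_diag (b : {dot V for idfun}) (a : 'I_n -> nat) w :
  \matrix_(i, j) b (tnth v i) (tnth v j) = diag_mx (\row_j (a j)%:R) ->
  phip b w = \sum_j (a j)%:R * padic_coord j w ^+ 2.
Proof.
move=> /matrixP bE.
have bvE (i j : 'I_n) : b v`_i v`_j = (a i)%:R *+ (i == j).
  by have := bE i j; rewrite !mxE !(tnth_nth 0).
have beE x y : b x y = \sum_j (a j)%:R * coord v j x * coord v j y.
  rewrite {1}(coord_basis bv (memvf x)) {1}(coord_basis bv (memvf y)).
  rewrite linear_sumlz; apply: eq_bigr => i _.
  rewrite linearZl_LR linear_sumr (bigD1 i) //= big1 ?addr0 => [|j ji].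
    by rewrite linearZr_LR /= bvE eqxx mulr1n mulrA mulrC mulrA.
  by rewrite linearZr_LR /= bvE eq_sym (negPf ji) mulr0.
rewrite /phip /bp.
transitivity (\sum_i \sum_k \sum_j (a j)%:R *
    ((w 0 i * ratr (coord v j e`_i)) * (w 0 k * ratr (coord v j e`_k))) : Qp).
  apply: eq_bigr => i _; apply: eq_bigr => k _; rewrite beE ratr_Qp_sum mulr_sumr.
  apply: eq_bigr => j _; rewrite !ratr_QpM ratr_Qp_nat.
  have aux (F : comNzRingType) (x y al r s : F) :
    x * y * (al * r * s) = al * (x * r * (y * s)) by ring.
  exact: aux.
under eq_bigr => i _ do rewrite exchange_big.
rewrite exchange_big; apply: eq_bigr => j _ /=.
rewrite expr2 mulr_suml mulr_sumr; apply: eq_bigr => i _.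
by rewrite !mulr_sumr.
Qed.

End lattice_coordinates.

(** * The inner integral over V_p *)

Section density.
Variables (R : realType) (V : vectType rat) (b : {dot V for idfun}).
Variables (n : nat) (v : n.-tuple V) (a : 'I_n -> nat) (c : int) (N : nat) (h : rat).
Variables (p : nat) (p_pr : prime p).
Local Notation Qp := (Qp p_pr).
Local Notation Zp := (padic_int p_pr).
Local Notation Vp := (Vp p_pr V).
Local Notation toVp := (toVp p_pr).
Local Notation nu := (- (c%:~R / N%:R) *: \sum_i tnth v i).
Local Notation X := (@Xp p p_pr V (zlattice v) nu).
Local Notation y := (@padic_coord p p_pr V n v).
Local Notation kappa := (ratr (c%:~R / N%:R) : Qp).

Definition integrand (sigma : Qp) (w : Vp) : R[i] :=
  @ep R p p_pr (sigma * (phip b w - ratr h)) * lambdap R p_pr (zlattice v) nu w.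

Hypotheses (bv : basis_of {:V} v)
  (gram : \matrix_(i, j) b (tnth v i) (tnth v j) = diag_mx (\row_j (a j)%:R))
  (a_gcd : \big[gcdn/0%N]_j a j = 1%N) (N_gt0 : (0 < N)%N)
  (cN : coprimez c N%:Z)
  (hE : exists m : int, h - \sum_j (a j)%:R * (c%:~R / N%:R) ^+ 2
                        = 8%:R / (gcdn N 4 * N)%:R * m%:~R)
  (p_odd : odd p) (pN : (p %| N)%N).

Let N_neq0 : N%:R != 0 :> Qp. Proof. by rewrite natr_Qp_eq0 -lt0n. Qed.

Let p_neq0 : p%:R != 0 :> Qp. Proof. by rewrite natr_Qp_eq0 -lt0n prime_gt0. Qed.

Let NkappaE : N%:R * kappa = c%:~R.
Proof. by rewrite ratr_QpM ratr_QpV ratr_Qp_int ratr_Qp_nat mulrCA divff ?mulr1. Qed.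

(** Every coordinate of [nu] is [- kappa], whence the plus sign. *)
Lemma mem_Xp w : X w <-> forall j, Zp (y j w + kappa).
Proof.
have nuE j : ratr (coord v j nu) = - kappa.
  rewrite linearZ /= (eq_bigr (fun i : 'I_n => 1 *: v`_i)); last first.
    by move=> i _; rewrite scale1r (tnth_nth 0).
  by rewrite coord_sum_free ?(basis_free bv) // mulr1 ratr_QpN.
rewrite (XpE bv); split => wX j; have := wX j; by rewrite nuE opprK.
Qed.

Lemma Xp_translate w w' : (forall j, Zp (y j w')) -> X (w + w') <-> X w.
Proof.
move=> w'Z; rewrite !mem_Xp; split => wX j; have := wX j; rewrite padic_coordD.
  by move=> wj; have := padic_intB wj (w'Z j); rewrite addrAC addrK.
by move=> wj; have := padic_intD wj (w'Z j); rewrite addrAC.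
Qed.

(** With z = y_j + kappa in Z_p and N kappa = c, one has N (y_j^2 - kappa^2) = (N z - 2c) z, which
    is integral. The hypothesis on [h] leaves only 8m / gcd(N, 4). *)
Lemma phase_int t w : Zp t -> X w -> Zp (t * N%:R * (phip b w - ratr h)).
Proof.
move=> tZ /mem_Xp wX; have [m mE] := hE.
(* gcd(N, 4) divides 4 and p is odd, so it is a p-adic unit. *)
have g_unit : Qp_norm ((gcdn N 4)%:R : Qp) = 1.
  apply: padic_unit_nat; rewrite prime_coprime //.
  apply: contraL p_odd => /dvdn_trans/(_ (dvdn_gcdr _ _)).
  by rewrite -[4%N]/(2 ^ 2)%N Euclid_dvdX // dvdn_prime2 // andbT => /eqP ->.
have g_neq0 : (gcdn N 4)%:R != 0 :> Qp by rewrite -Qp_norm_eq0 g_unit oner_eq0.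
have -> : ratr h = \sum_j (a j)%:R * kappa ^+ 2 +
    8%:R / ((gcdn N 4)%:R * N%:R) * m%:~R :> Qp.
  rewrite -[h](subrK (\sum_j (a j)%:R * (c%:~R / N%:R) ^+ 2)) mE addrC ratr_QpD.
  rewrite ratr_Qp_sum ratr_QpM ratr_Qp_int ratr_QpM ratr_QpV !ratr_Qp_nat natrM.
  congr (_ + _); apply: eq_bigr => j _.
  by rewrite ratr_QpM ratr_Qp_nat expr2 ratr_QpM -expr2.
rewrite (phip_diag bv w gram) opprD addrA -sumrB -mulrA; apply: padic_intM => //.
rewrite mulrDr mulr_sumr; apply: padic_intD.
  apply: padic_int_sum => j _.
  have aux (F : fieldType) (al x k M d : F) : M * k = d ->
      M * (al * x ^+ 2 - al * k ^+ 2) = al * ((M * (x + k) - (1 + 1) * d) * (x + k)).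
    by move=> <-; ring.
  rewrite (aux _ _ _ _ _ _ NkappaE); apply: padic_intM; first exact: padic_int_nat.
  apply: padic_intM => //; apply: padic_intB.
    by apply: padic_intM => //; exact: padic_int_nat.
  by apply: padic_intM; [exact: (padic_int_nat p_pr 2)|exact: padic_int_int].
have aux (F : fieldType) (al g M d : F) : g != 0 -> M != 0 ->
    M * - (al / (g * M) * d) = - (al * d / g) by move=> g0 M0; field; rewrite g0.
rewrite aux //; apply: padic_intN; rewrite /padic_int /= Qp_normM Qp_normV g_unit.
rewrite invr1 mulr1; apply: padic_intM; first exact: padic_int_nat.
exact: padic_int_int.
Qed.

(** Expand (x + u)^2 - x^2 = 2xu + u^2 and substitute N x = N (x + kappa) - c. If x + kappa and u
    are integral, the behaviour of the phase is then governed by t u. *)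
Lemma phase_shift t w w' :
  t * N%:R * (phip b (w + w') - phip b w) =
  \sum_j (a j)%:R * ((1 + 1) * (N%:R * (y j w + kappa) - c%:~R) * (t * y j w') +
                     N%:R * (t * y j w') * y j w').
Proof.
rewrite !(phip_diag bv _ gram) -sumrB mulr_sumr; apply: eq_bigr => j _.
rewrite padic_coordD.
have aux (F : fieldType) (al x u k M d r : F) : M * k = d ->
    r * M * (al * (x + u) ^+ 2 - al * x ^+ 2) =
    al * ((1 + 1) * (M * (x + k) - d) * (r * u) + M * (r * u) * u).
  by move=> <-; ring.
exact: aux NkappaE.
Qed.

(** Every factor in [phase_shift] is integral. This gives the local constancy of the integrand. *)
Lemma phase_shift_int t w w' : X w -> (forall j, Zp (y j w')) ->
  (forall j, Zp (t * y j w')) ->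
  Zp (t * N%:R * (phip b (w + w') - phip b w)).
Proof.
move=> /mem_Xp wX w'Z tw'Z; rewrite phase_shift; apply: padic_int_sum => j _.
have NZ := padic_int_nat p_pr N.
apply: padic_intM; first exact: padic_int_nat.
apply: padic_intD; last by apply: padic_intM => //; exact: padic_intM.
apply: padic_intM => //; apply: padic_intM; first exact: (padic_int_nat p_pr 2).
by apply: padic_intB; [exact: padic_intM|exact: padic_int_int].
Qed.

Lemma padic_coord_basis (j i : 'I_n) (s : Qp) : y j (s *: toVp (tnth v i)) = s *+ (i == j).
Proof.
rewrite padic_coordZ padic_coord_toVp (tnth_nth 0) coord_free ?(basis_free bv) //.
by rewrite ratr_Qp_nat mulr_natr.
Qed.

(** For this translation t y_i = 1/p, so the term in c contributes -2 a_i c / p, and the other terms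
    carry the factor N/p. *)
Lemma phase_shift_basis t w (i : 'I_n) : X w -> t != 0 -> Zp (t^-1 / p%:R) ->
  Zp (t * N%:R * (phip b (w + (t^-1 / p%:R) *: toVp (tnth v i)) - phip b w) -
      - ((2 * a i)%:R * c%:~R / p%:R)).
Proof.
move=> /mem_Xp wX t0 sZ; rewrite phase_shift (bigD1 i) //= big1 ?addr0 => [|j ji].
  rewrite padic_coord_basis eqxx mulr1n.
  have -> : t * (t^-1 / p%:R) = p%:R^-1 by rewrite mulrA divff // div1r.
  (* Divisibility of N by p makes N/p an integer, so all terms but the one in c are integral. *)
  have NE : N%:R = (N %/ p)%:R * p%:R :> Qp by rewrite -natrM divnK.
  have aux (F : fieldType) (al z M d s q : F) : q != 0 ->
      al * ((1 + 1) * ((M * q) * z - d) * q^-1 + (M * q) * q^-1 * s) -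
        - ((1 + 1) * al * d / q) = al * M * ((1 + 1) * z + s).
    by move=> q0; field.
  rewrite NE natrM aux //; apply: padic_intM.
    by apply: padic_intM; exact: padic_int_nat.
  by apply: padic_intD => //; apply: padic_intM => //; exact: (padic_int_nat p_pr 2).
rewrite padic_coord_basis eq_sym (negPf ji) mulr0n !mulr0 addr0 mulr0; exact: erefl.
Qed.

Lemma padic_unit_divp (u : Qp) : Qp_norm u = 1 -> ~ Zp (u / p%:R).
Proof.
rewrite /padic_int /= Qp_normM Qp_normV Qp_norm_p invrK => ->; rewrite mul1r.
by apply/negP; rewrite -ltNge ltr1n prime_gt1.
Qed.

Lemma exists_unit_coefficient : exists i, coprime p (a i).
Proof.
apply: contrapT => /forallNP na.
have : (p %| \big[gcdn/0%N]_j a j)%N.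
  apply: (big_ind (fun m => p %| m)%N) => [|x z px pz|i _]; rewrite ?dvdn0 ?dvdn_gcd ?px //.
  by have := na i; rewrite prime_coprime // => /negP; rewrite negbK.
by rewrite a_gcd dvdn1 => /eqP p1; move: (prime_gt1 p_pr); rewrite p1.
Qed.

(** 2 a_i c is a p-adic unit: p is odd, prime to a_i, and prime to c because it divides N. Hence the
    argument of [ep] is not in Z_p. *)
Lemma multiplier_neq1 i : coprime p (a i) ->
  @ep R p p_pr (- ((2 * a i)%:R * c%:~R / p%:R)) != 1.
Proof.
move=> pa; apply/eqP => /ep_eq1; rewrite -mulNr; apply: padic_unit_divp.
rewrite Qp_normN Qp_normM padic_unit_nat; last first.
  by rewrite coprimeMr pa andbT prime_coprime // dvdn_prime2 //; apply: contraL p_odd => /eqP ->.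
rewrite mul1r -ratr_Qp_int Qp_norm_ratr padic_abs_int padic_abs_unit //.
by move: cN; rewrite coprimezE absz_nat coprime_sym => /(coprime_dvdl pN).
Qed.

Lemma indic_Xp_translate w w' : (forall j, Zp (y j w')) ->
  \1_X (w + w') = \1_X w :> R.
Proof.
move=> w'Z; rewrite !indicE; congr (_%:R); congr nat_of_bool.
by apply/idP/idP => /set_mem/(Xp_translate w w'Z) ?; apply/mem_set.
Qed.

Lemma integrand_out sigma w : ~ X w -> integrand sigma w = 0.
Proof. by move=> wX; rewrite /integrand /lambdap indicE memNset // mulr0. Qed.

(** Both sides vanish off X, so the phase matters only on X. The case z = 0 gives local constancy,
    and a nontrivial multiplier gives the vanishing of the integral. *)
Lemma integrand_shift sigma w w' z : (forall j, Zp (y j w')) ->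
  (X w -> Zp (sigma * (phip b (w + w') - phip b w) - z)) ->
  integrand sigma (w + w') = @ep R p p_pr z * integrand sigma w.
Proof.
move=> w'Z phase; have [wX|wX] := pselect (X w); last first.
  have w'X : ~ X (w + w') by move/(Xp_translate w w'Z).
  by rewrite (integrand_out _ w'X) (integrand_out _ wX) mulr0.
rewrite /integrand /lambdap indic_Xp_translate // mulrA -epD; congr (_ * _).
have aux (F : comNzRingType) (s u u' k r : F) :
  s * (u' - k) = (r + s * (u - k)) + (s * (u' - u) - r) by ring.
by rewrite (aux _ _ (phip b w) _ _ z) [LHS]epD (ep_int R (phase wX)) mulr1.
Qed.

Lemma Xp_open : open X.
Proof.
apply/rVQp_openP => w wX; have [d d0 small] := padic_coord_small p_pr v ltr01.
by exists d => // w' w'd; apply/Xp_translate => // j; apply: ltW; exact: small.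
Qed.

(** The integrand is locally constant: for small w', both w' and t w' have integral coordinates, so
    the phase changes by an element of Z_p. *)
Lemma integrand_open sigma (A : set R[i]) : open (integrand sigma @^-1` A).
Proof.
pose t := sigma / N%:R; have sE : sigma = t * N%:R by rewrite divfK.
(* The bound 1 makes y_j(w') integral, and 1 / (1 + |t|) makes t y_j(w') integral, including when t
   = 0. *)
have d0 : 0 < Num.min 1 (1 / (1 + Qp_norm t)).
  by rewrite lt_min ltr01 divr_gt0 // ltr_pwDl // Qp_norm_ge0.
apply/rVQp_openP => w wA; have [d d0' small] := padic_coord_small p_pr v d0.
exists d => // w' /small w'd.
have w'Z j : Zp (y j w').
  by have := w'd j; rewrite lt_min => /andP[/ltW].
have tw'Z j : Zp (t * y j w').
  have := w'd j; rewrite lt_min => /andP[_ /ltW w'j].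
  rewrite /padic_int /= Qp_normM.
  have t1 : 0 < 1 + Qp_norm t by rewrite ltr_pwDl // Qp_norm_ge0.
  apply: le_trans (ler_wpM2l (Qp_norm_ge0 t) w'j) _.
  by rewrite mulrA mulr1 ler_pdivrMr // mul1r lerDr.
rewrite /preimage /= (integrand_shift (z := 0)) //.
  by rewrite (ep_int R (padic_int0 p_pr)) mul1r.
by move=> wX; rewrite subr0 sE; exact: phase_shift_int.
Qed.

Variable dv : {measure set (borel Vp) -> \bar R}.
Hypotheses (dv_haar : haar_Vp dv) (dv1 : dv (Lp p_pr (zlattice v)) = 1%E).

Lemma Lp_open : open (Lp p_pr (zlattice v)).
Proof.
apply/rVQp_openP => w /(LpE bv) wL; have [d d0 small] := padic_coord_small p_pr v ltr01.
exists d => // w' w'd; apply/(LpE bv) => j; rewrite padic_coordD.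
by apply: padic_intD => //; apply: ltW; exact: small.
Qed.

Lemma dv_Xp : dv X = 1%E.
Proof.
have [inv _ _] := dv_haar; rewrite -dv1 -(inv (toVp nu) (Lp p_pr (zlattice v))).
  by congr (dv _); apply/seteqP; split => _ [w wL <-]; exists w; rewrite // addrC.
by apply: open_borel; exact: Lp_open.
Qed.

(** [F] stands for the real or imaginary part. Local constancy gives measurability, and the
    indicator of X, a set of measure 1, dominates. *)
Lemma integrand_integrable sigma (F : R[i] -> R) :
  (forall z : R[i], forall r : R, F (z * r%:C%C) = F z * r) ->
  (forall z, `|F (@ep R p p_pr z)| <= 1) ->
  dv.-integrable [set: borel Vp] (EFin \o (fun w => F (integrand sigma w))).
Proof.
move=> Fr F1; apply: (@le_indic_integrable _ (borel Vp) R dv X (fun w => F (integrand sigma w))).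
- by apply: open_borel; exact: Xp_open.
- by rewrite dv_Xp ltry.
- apply: open_preimage_measurable => A.
  exact: (@integrand_open sigma (F @^-1` A)).
- move=> w; rewrite /integrand /lambdap Fr normrM [X in _ * X]ger0_norm //.
  by rewrite ler_piMl // F1.
Qed.

Lemma inner_integral sigma :
  cintegral dv (integrand sigma) = (\1_[set s : Qp | Zp (s / N%:R)] sigma : R)%:C%C.
Proof.
pose t := sigma / N%:R; have sE : sigma = t * N%:R by rewrite divfK.
have mX : measurable (X : set (borel Vp)) by apply: open_borel; exact: Xp_open.
have [tZ|tZ] := pselect (Zp t).
  rewrite [in RHS]indicE mem_set //= (_ : integrand sigma = fun w => (\1_X w : R)%:C%C).
    by rewrite cintegral_indic // dv_Xp.
  apply/funext => w; have [wX|wX] := pselect (X w); last first.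
    by rewrite integrand_out // indicE memNset.
  by rewrite /integrand ep_int ?mul1r // sE; exact: phase_int.
rewrite [in RHS]indicE memNset //=.
have t0 : t != 0 by apply/eqP => t0; apply: tZ; rewrite t0; exact: padic_int0.
(* Here |t| > 1, so |1/t| < 1, and discreteness of the norm leaves room to divide by p. Translation
   by [s0] therefore preserves X. *)
have sZ : Zp (t^-1 / p%:R).
  apply: padic_int_divp; rewrite Qp_normV invf_lt1 ?Qp_norm_gt0 //.
  by rewrite ltNge; apply/negP.
have [i pa] := exists_unit_coefficient.
pose s0 : Vp := (t^-1 / p%:R) *: toVp (tnth v i).
apply: (@cintegral_comp_eq0 _ _ _ dv (fun w => s0 + w) _ _ _ _ _ _ _ (multiplier_neq1 pa)).
- by apply: borel_measurable_fun => A; exact: rVQp_translation_open.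
- move=> A mA; apply: (haar_preimage (s' := - s0) dv_haar) => // w.
    by rewrite addKr.
  by rewrite addNKr.
- apply: integrand_integrable; last exact: ep_Re_le1.
  by case=> x z r /=; rewrite mulr0 subr0.
- apply: integrand_integrable; last exact: ep_Im_le1.
  by case=> x z r /=; rewrite mulr0 add0r.
- move=> w; rewrite addrC; apply: integrand_shift => [j|wX].
    by rewrite padic_coord_basis; case: eqP => _; [exact: sZ|exact: padic_int0].
  by rewrite sE; exact: phase_shift_basis.
Qed.

End density.

(** * The outer integral over Q_p *)

Theorem theorem3p4 (R : realType) (V : vectType rat) (b : {dot V for idfun})
    (n : nat) (v : n.-tuple V) (a : 'I_n -> nat) (c : int) (N : nat) (h : rat) :
  let L := zlattice v in
  let nu := - (c%:~R / N%:R) *: \sum_i tnth v i in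
  basis_of {:V} v ->
  ~~ odd n ->
  \matrix_(i, j) b (tnth v i) (tnth v j) = diag_mx (\row_j (a j)%:R) ->
  (forall j, 0 < a j)%N ->
  \big[gcdn/0%N]_j a j = 1%N ->
  (0 < N)%N ->
  coprimez c N%:Z ->
  (exists m : int, h - \sum_j (a j)%:R * (c%:~R / N%:R) ^+ 2
                   = 8%:R / (gcdn N 4 * N)%:R * m%:~R) ->
  forall (p : nat) (p_pr : prime p), odd p -> (p %| N)%N ->
  forall (dv : {measure set (borel (Vp p_pr V)) -> \bar R})
         (dsigma : {measure set (borel (Qp p_pr)) -> \bar R}),
  haar_Vp dv -> dv (Lp p_pr L) = 1%E ->
  haar_Qp dsigma -> dsigma (padic_int p_pr) = 1%E ->
  local_density dv dsigma b (lambdap R p_pr L nu) h = p%:R ^- logn p N.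
Proof.
move=> L nu bv _ gram _ a_gcd N_gt0 cN hE p p_pr p_odd pN dv dsigma dv_haar dv1.
move=> ds_haar ds1; rewrite /local_density.
rewrite (_ : (fun sigma => _) = fun sigma : Qp p_pr =>
    (\1_[set s | padic_int p_pr (s / N%:R)] sigma : R)%:C%C); last first.
  by apply/funext => sigma; exact: (inner_integral bv gram a_gcd N_gt0 cN hE p_odd pN dv_haar dv1).
(* N and p^(ord_p N) have the same p-adic norm, so they generate the same Z_p-submodule of Q_p. *)
have -> : [set s | padic_int p_pr (s / N%:R)] =
    [set s : Qp p_pr | padic_int p_pr (s / p%:R ^+ logn p N)].
  apply/funext => s; rewrite /padic_int /= !Qp_normM !Qp_normV -natrX.
  by rewrite (Qp_norm_nat p_pr N_gt0) Qp_norm_nat ?expn_gt0 ?prime_gt0 // pfactorK.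
have pk0 : p%:R ^+ logn p N != 0 :> Qp p_pr.
  by rewrite expf_neq0 // natr_Qp_eq0 -lt0n prime_gt0.
rewrite cintegral_indic; last first.
  apply: open_borel; rewrite (_ : mkset _ =
    [set s : Qp p_pr | padic_int p_pr ((s - 0) / p%:R ^+ logn p N)]).
    exact: Qp_ideal_coset_open.
  by apply/seteqP; split => s /=; rewrite subr0.
by rewrite haar_Qp_ideal //= fmorphV rmorphXn /= rmorph_nat.
Qed.
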